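(* Let $u,v\in L_g^1([a,b))$ and $u_a,u_b\in\mathbb F$. The following statements are equivalent: (i) $v$ is the weak $g$-derivative of the traced state $([u],u_a,u_b)$, i.e. for every $\varphi\in\mathcal T_g$, $$\int_{[a,b)}u\,D_g\varphi\,d\mu_g+\int_{[a,b)}v\,S_g\varphi\,d\mu_g=u_b\varphi(b)-u_a\varphi(a);$$ (ii) there exists $U\in AC_g([a,b])$ such that $U=u$ $\mu_g$-a.e., $U(a)=u_a$, $U(b)=u_b$, and $D_gU=v$ $\mu_g$-a.e.; (iii) the function $U(t):=u_a+\int_{[a,t)}v(s)\,d\mu_g(s)$, $t\in[a,b]$, represents $[u]$ (i.e. $U=u$ $\mu_g$-a.e.) and satisfies both endpoint conditions $U(a)=u_a$ and $U(b)=u_b$. In particular, the weak derivative of a traced state, when it exists, is unique (as an element of $L_g^1([a,b))$).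
   Context: Let $\mathbb F$ be $\mathbb R$ or $\mathbb C$, let $a<b$ be real, and let $g:[a,b]\to\mathbb R$ be nondecreasing and left-continuous. $\mu_g$ is the finite Lebesgue--Stieltjes measure on $[a,b)$ with $\mu_g([s,t))=g(t)-g(s)$ for $a\le s\le t\le b$. Standing assumption: $M_g:=\mu_g([a,b))=g(b)-g(a)>0$. For $1\le p\le\infty$, $L_g^p([a,b))$ is the $L^p$ space of $\mathbb F$-valued functions for the completion of $\mu_g$ (modulo $\mu_g$-a.e. equality); $[u]$ denotes the class of $u$. $J_g:=\{t\in[a,b):\Delta g(t):=g(t^+)-g(t)>0\}$ is the set of jump points, so $\mu_g(\{t\})=\Delta g(t)$ for $t\in J_g$. $AC_g([a,b])$ is the set of $u:[a,b]\to\mathbb F$ such that for every $\varepsilon>0$ there is $\delta>0$ such that, for every finite family of pairwise disjoint intervals $[a_j,b_j)\subset[a,b)$, $\sum_j(g(b_j)-g(a_j))<\delta$ implies $\sum_j|u(b_j)-u(a_j)|<\varepsilon$. It is known that $u\in AC_g([a,b])$ if and only if there is $v\in L_g^1([a,b))$ with $u(t)=u(a)+\int_{[a,t)}v\,d\mu_g$ for all $t\in[a,b]$; $v$ is unique $\mu_g$-a.e. and the Stieltjes derivative is $D_gu:=v$. Posterior trace: for $u\in AC_g([a,b])$, $S_gu(t):=u(t^+)$ if $t\in J_g$ and $S_gu(t):=u(t)$ if $t\notin J_g$. Test space: $\mathcal T_g$ is the set of functions $\varphi:[a,b]\to\mathbb F$ of the form $\varphi(t)=c+\int_{[a,t)}\psi\,d\mu_g$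 with $c\in\mathbb F$ and $\psi\in L_g^\infty([a,b))$ (so $D_g\varphi=\psi$). *)

(* Defs.v *)
From HB Require Import structures.
From mathcomp Require Import all_boot all_order all_algebra.
From mathcomp Require Import all_classical all_reals all_analysis.
From mathcomp.real_closed Require Import complex.
From mathcomp Require Import lra.

Set Implicit Arguments.
Unset Strict Implicit.
Unset Printing Implicit Defensive.
Import Order.TTheory GRing.Theory Num.Theory.
Import numFieldNormedType.Exports.
Local Open Scope classical_set_scope.
Local Open Scope ring_scope.

Inductive scalar_kind := RealScalars | ComplexScalars.

Definition scalar_field (R : realType) (k : scalar_kind) : numFieldType :=
  match k with RealScalars => R | ComplexScalars => complex R end.

Section Scalars.
Context {R : realType} {k : scalar_kind}.

Definition scalar_re : scalar_field R k -> R :=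
  match k return scalar_field R k -> R with
  | RealScalars => fun z => z
  | ComplexScalars => fun z => complex.Re z
  end.

Definition scalar_im : scalar_field R k -> R :=
  match k return scalar_field R k -> R with
  | RealScalars => fun=> 0
  | ComplexScalars => fun z => complex.Im z
  end.

Definition mk_scalar (x y : R) : scalar_field R k :=
  match k return scalar_field R k with
  | RealScalars => x
  | ComplexScalars => Complex x y
  end.

(* The library norm of [complex R] takes its (real) values in [complex R]. *)
Definition scalar_abs (z : scalar_field R k) : R := scalar_re `|z|.

End Scalars.

(* Functions on [a, b] are represented by functions on R whose values outside
   of [a, b] are never used. *)
Record derivator (R : realType) (a b : R) := Derivator {
  derivator_fun :> R -> R ;
  derivator_nondecreasing :
    {in `[a, b] &, {homo derivator_fun : x y / x <= y}} ;
  derivator_left_continuous :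
    forall t, t \in `]a, b] -> derivator_fun x @[x --> t^'-] --> derivator_fun t
}.

(* The library's Lebesgue-Stieltjes measures are defined from right-continuous
   functions F, by mu ]x, y] = F y - F x. For a left-continuous g, extended by
   constants outside of [a, b], the right-continuous F(t) := g(t^+) gives the
   measure with mu [s, t[ = g t - g s; see [mu_g_itvco] below. *)
Section RightLimit.
Context {R : realType} {a b : R} (g : derivator a b).

Definition derivator_ext (x : R) : R := g (Num.max a (Num.min x b)).

Definition derivator_right (x : R) : R :=
  lim (derivator_ext y @[y --> x^'+]).

Lemma derivator_ext_nd : {homo derivator_ext : x y / x <= y}.
Proof.
move=> x y xy; rewrite /derivator_ext; have [ab|ba] := leP a b; last first.
  by rewrite !max_l// ge_min (ltW ba) orbT.
apply: derivator_nondecreasing.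
- by rewrite in_itv/= le_max lexx/= ge_max ab/= ge_min lexx orbT.
- by rewrite in_itv/= le_max lexx/= ge_max ab/= ge_min lexx orbT.
- by rewrite ge_max !le_max lexx/= le_min !ge_min xy lexx/= !orbT.
Qed.

Lemma derivator_right_cvg x :
  derivator_ext y @[y --> x^'+] --> derivator_right x.
Proof.
apply: nondecreasing_at_right_is_cvgr.
- by near=> y => u v _ _; exact: derivator_ext_nd.
- near=> y; exists (derivator_ext x) => _ [u uI <-].
  by apply: derivator_ext_nd; move: uI; rewrite /= in_itv/= => /andP[/ltW].
Unshelve. all: by end_near. Qed.

Lemma derivator_ext_le_right x : derivator_ext x <= derivator_right x.
Proof.
apply: (limr_ge (F := x^'+) (f := derivator_ext)).
  by apply/cvg_ex; exists (derivator_right x); exact: derivator_right_cvg.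
near=> y; apply: derivator_ext_nd.
by near: y; apply: nbhs_right_ge.
Unshelve. all: by end_near. Qed.

Lemma derivator_right_le_ext x y : x < y -> derivator_right x <= derivator_ext y.
Proof.
move=> xy; apply: (limr_le (F := x^'+) (f := derivator_ext)).
  by apply/cvg_ex; exists (derivator_right x); exact: derivator_right_cvg.
near=> z; apply: derivator_ext_nd.
by near: z; apply: nbhs_right_le.
Unshelve. all: by end_near. Qed.

Lemma derivator_right_nd : {homo derivator_right : x y / x <= y}.
Proof.
move=> x y; rewrite le_eqVlt => /predU1P[->//|xy].
exact: le_trans (derivator_right_le_ext xy) (derivator_ext_le_right y).
Qed.

Lemma derivator_right_rc : right_continuous derivator_right.
Proof.
move=> x; apply/cvgrPdist_le => e e0.
have /cvgrPdist_le/(_ _ e0) H := @derivator_right_cvg x.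
near x^'+ => y0.
have xy0 : x < y0 by near: y0; exact: nbhs_right_gt.
have le_e : `|derivator_right x - derivator_ext y0| <= e by near: y0; exact: H.
near=> y.
have xy : x <= y by near: y; exact: nbhs_right_ge.
have yy0 : y < y0 by near: y; exact: nbhs_right_lt.
rewrite distrC ger0_norm ?subr_ge0 ?derivator_right_nd//.
apply: le_trans le_e; rewrite distrC ger0_norm.
  by rewrite lerB// derivator_right_le_ext.
by rewrite subr_ge0 derivator_right_le_ext.
Unshelve. all: by end_near. Qed.

HB.instance Definition _ := isCumulative.Build R _ R derivator_right
  derivator_right_nd derivator_right_rc.

Lemma derivator_extE x : x \in `[a, b] -> derivator_ext x = g x.
Proof. by rewrite in_itv/= => /andP[ax xb]; rewrite /derivator_ext min_l// max_r. Qed.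

Lemma derivator_ext_lc x :
  x \in `[a, b] -> derivator_ext y @[y --> x^'-] --> derivator_ext x.
Proof.
move=> xab; have := xab; rewrite in_itv/= => /andP[ax xb].
move: ax; rewrite le_eqVlt => /predU1P[ax|ax].
  apply: cvg_near_cst; near=> y.
  have yx : y <= x by near: y; exact: nbhs_left_le.
  by rewrite /derivator_ext !max_l// ge_min ax ?yx ?lexx.
rewrite derivator_extE//.
have := @derivator_left_continuous _ _ _ g x; rewrite in_itv/= ax xb => /(_ isT).
apply: cvg_trans; apply: near_eq_cvg; near=> y; symmetry.
apply/derivator_extE; rewrite in_itv/=; apply/andP; split.
  by near: y; exact: nbhs_left_ge.
apply: le_trans xb; near: y; exact: nbhs_left_le.
Unshelve. all: by end_near. Qed.

Lemma derivator_right_lim x :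
  x \in `[a, b] -> derivator_right y @[y --> x^'-] --> derivator_ext x.
Proof.
move=> xab; apply: (squeeze_cvgr _ (derivator_ext_lc xab) (cvg_cst _)).
near=> y; rewrite derivator_ext_le_right/=; apply: derivator_right_le_ext.
by near: y; exact: nbhs_left_lt.
Unshelve. all: by end_near. Qed.

End RightLimit.

Section Stieltjes.
Context {R : realType} {k : scalar_kind} {a b : R}.
Variable g : derivator a b.
Local Notation F := (scalar_field R k).

(* The real line with the sigma-algebra of the Caratheodory-measurable sets,
   which is the completion of the Borel sigma-algebra for mu_g. *)
Local Notation LS_space :=
  (caratheodory_type (R := R) (T := ocitv_type R)
     (wlength (derivator_right g))^*%mu).

Definition mu_g : set LS_space -> \bar R :=
  completed_lebesgue_stieltjes_measure (derivator_right g).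

HB.instance Definition _ := Measure.on mu_g.
HB.instance Definition _ := SigmaFiniteMeasure.on mu_g.

Let lsm := lebesgue_stieltjes_measure (derivator_right g).

Let lsm_itvoc x y : x <= y ->
  lsm `]x, y] = (derivator_right g y - derivator_right g x)%:E.
Proof.
move=> xy; rewrite /lsm /lebesgue_stieltjes_measure /measure_extension.
by rewrite measurable_mu_extE/= ?wlength_itv_bnd//; exact: is_ocitv.
Qed.

Let lsm_set1 x : x \in `[a, b] ->
  lsm [set x] = (derivator_right g x - derivator_ext g x)%:E.
Proof.
move=> xab; rewrite set1_bigcap_oc.
set I := fun n => _.
have I1 n : lsm (I n) =
    (derivator_right g x - derivator_right g (x - n.+1%:R^-1))%:E.
  by rewrite lsm_itvoc// gerBl.
have : lsm (I n) @[n --> \oo] --> lsm (\bigcap_n I n).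
  apply: nonincreasing_cvg_mu.
  - by change (lsm (I 0%N) < +oo)%E; rewrite I1 ltry.
  - by move=> n; exact: measurable_itv.
  - by apply: bigcap_measurable => // n _; exact: measurable_itv.
  - move=> m n mn; apply/subsetPset/subset_itvr.
    by rewrite bnd_simp lerB// lef_pV2 ?posrE// ler_nat.
move/cvg_lim => <- //; apply/cvg_lim => //.
under eq_fun do rewrite I1.
apply/cvg_EFin; first exact: nearW.
apply: cvgB; first exact: cvg_cst.
have /cvg_at_leftP := derivator_right_lim (g := g) xab; apply; split.
  by move=> n; rewrite ltrBlDr ltrDl invr_gt0.
by rewrite -[X in _ --> X]subr0; apply: cvgB; [exact: cvg_cst|exact: cvg_harmonic].
Qed.

Lemma mu_g_itvco s t : a <= s -> s <= t -> t <= b ->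
  mu_g `[s, t[%classic = (g t - g s)%:E.
Proof.
move=> as_ st tb.
have sI : s \in `[a, b] by rewrite in_itv/= as_ (le_trans st).
have tI : t \in `[a, b] by rewrite in_itv/= tb (le_trans as_).
have eqU : (`[s, t[ `|` [set t] = [set s] `|` `]s, t])%classic.
  by rewrite setUitv1 ?setU1itv ?bnd_simp.
have : lsm (`[s, t[ `|` [set t]) = lsm ([set s] `|` `]s, t]) by rewrite eqU.
have mitv (i : interval R) : measurable ([set` i] : set (measurableTypeR R)).
  exact: measurable_itv.
have mset1 (x : R) : measurable ([set x] : set (measurableTypeR R)).
  exact: measurable_set1.
have lsmU (A B : set (measurableTypeR R)) : measurable A -> measurable B ->
    A `&` B = set0 -> lsm (A `|` B) = (lsm A + lsm B)%E.
  exact: (measureU (lebesgue_stieltjes_measure (derivator_right g))).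
rewrite !lsmU//; first last.
- by apply/seteqP; split=> // x [/=]; rewrite in_itv/= => /[swap] ->; rewrite ltxx andbF.
- by apply/seteqP; split=> // x [/=] ->; rewrite in_itv/= ltxx.
rewrite !lsm_set1// lsm_itvoc// !derivator_extE//.
change (mu_g `[s, t[%classic) with (lsm `[s, t[%classic).
case: (lsm `[s, t[%classic) => [r| |]//=.
by rewrite -!EFinD => -[] h; congr EFin; move: h; lra.
Qed.

Definition LS_measurable (f : R -> F) : Prop :=
  measurable_fun (`[a, b[ : set LS_space) (fun t : LS_space => scalar_re (f t)) /\
  measurable_fun (`[a, b[ : set LS_space) (fun t : LS_space => scalar_im (f t)).

(* L^p functions are representatives; classes are handled through [eq_ae_g]. *)
Definition L1_g (f : R -> F) : Prop :=
  LS_measurable f /\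
  (\int[mu_g]_(t in `[a, b[%classic) (scalar_abs (f t))%:E < +oo)%E.

Definition Linfty_g (f : R -> F) : Prop :=
  LS_measurable f /\
  exists M : R, \forall t \ae mu_g, `[a, b[%classic t -> scalar_abs (f t) <= M.

Definition integral_g (D : set R) (f : R -> F) : F :=
  mk_scalar (Rintegral mu_g D (fun t => scalar_re (f t)))
            (Rintegral mu_g D (fun t => scalar_im (f t))).

Definition eq_ae_g (f h : R -> F) : Prop :=
  ae_eq mu_g `[a, b[%classic (f : LS_space -> F) (h : LS_space -> F).

Definition AC_g (u : R -> F) : Prop :=
  forall e : R, 0 < e -> exists2 d : R, 0 < d &
    forall (n : nat) (x y : 'I_n -> R),
      (forall j, [/\ a <= x j, x j < y j & y j <= b]) ->
      trivIset [set: 'I_n] (fun j => `[x j, y j[%classic) ->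
      \sum_(j < n) (g (y j) - g (x j)) < d ->
      \sum_(j < n) scalar_abs (u (y j) - u (x j)) < e.

(* D_g u is a class modulo mu_g-a.e. equality, hence a relation:
   [stieltjes_derivative u v] says that v is a representative of D_g u. *)
Definition stieltjes_derivative (u v : R -> F) : Prop :=
  L1_g v /\
  forall t, t \in `[a, b] -> u t = u a + integral_g `[a, t[%classic v.

Definition jump (t : R) : R := lim (g s @[s --> t^'+]) - g t.

Definition jump_set : set R := [set t | (t \in `[a, b[) /\ 0 < jump t].

Definition posterior_trace (u : R -> F) (t : R) : F :=
  if t \in jump_set then lim (u s @[s --> t^'+]) else u t.

Definition test_space (phi : R -> F) : Prop :=
  exists (c : F) (psi : R -> F), Linfty_g psi /\
    forall t, t \in `[a, b] -> phi t = c + integral_g `[a, t[%classic psi.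

Definition weak_derivative (u : R -> F) (ua ub : F) (v : R -> F) : Prop :=
  forall phi Dphi : R -> F, test_space phi -> stieltjes_derivative phi Dphi ->
    integral_g `[a, b[%classic (fun t => u t * Dphi t) +
    integral_g `[a, b[%classic (fun t => v t * posterior_trace phi t) =
    ub * phi b - ua * phi a.

End Stieltjes.

Arguments mu_g {R a b} g _.

(* Main.v *)
(** The engine is integration by parts for [mu_g], a consequence of Fubini on
    the square [a, c[ x [a, c[ cut along the diagonal: with
    V(t) = int_[a, t[ v and Psi^+(t) = int_[a, t] psi,
      int V psi + int v Psi^+ = (int v) (int psi).
    The posterior trace of phi = c + int_[a, .[ psi is c + Psi^+, also at the
    jumps, so this identity says that U = ua + V satisfies the weak equation
    with endpoint values ua and U(b).  Subtracting it from the weak equation of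
    u leaves int (u - U) psi = (ub - U(b)) phi(b) for all test functions:
    phi = 1 gives U(b) = ub, and indicators psi give u = U almost everywhere.
    For uniqueness, let W = int_[a, .[ w vanish almost everywhere and at b.
    Almost everywhere w W^+ = w^2 mu_g{t} >= 0, while int_[a, c[ w W^+ = W(c)^2
    by parts; c = b makes the integral over [a, b[ vanish, hence W = 0
    everywhere, and w = 0 almost everywhere by a monotone class argument and
    outer regularity.  Real and imaginary parts are treated separately. *)

Require Import Defs.
From mathcomp Require Import all_boot all_order all_algebra.
From mathcomp Require Import all_classical all_reals all_analysis.
From mathcomp Require Import measurable_realfun.
From mathcomp.real_closed Require Import complex.
From mathcomp Require Import ring.

Set Implicit Arguments.
Unset Strict Implicit.
Unset Printing Implicit Defensive.
Import Order.TTheory GRing.Theory Num.Theory.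
Import numFieldNormedType.Exports.
Local Open Scope classical_set_scope.
Local Open Scope ring_scope.

(** * Fubini on a product cut along a measurable set *)

Lemma integrable_fubini_G d1 d2 (T1 : measurableType d1) (T2 : measurableType d2)
    (R : realType) (m1 : {sigma_finite_measure set T1 -> \bar R})
    (m2 : {sigma_finite_measure set T2 -> \bar R}) (f : T1 * T2 -> \bar R) :
  (m1 \x m2)%E.-integrable setT f -> m2.-integrable setT (fubini_G m1 f).
Proof.
move=> fi; have mf := measurable_int _ fi.
apply/integrableP; split; first exact: (measurable_fubini_G fi).
(* The norm of a partial integral is at most the partial integral of the norm, which has finite
   integral by Tonelli. *)
apply: le_lt_trans ((integrable21ltyP m1 m2 mf).1 fi).
apply: ge0_le_integral => //=.
- by apply: measurableT_comp => //; exact: (measurable_fubini_G fi).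
- apply: (measurable_fun_fubini_tonelli_G (abse \o f)) => //=.
  exact: measurableT_comp.
- by move=> y _; apply: le_abse_integral => //; exact: measurableT_comp.
Qed.

Lemma ae_eq_Rintegral d (T : measurableType d) (R : realType)
    (m : {measure set T -> \bar R})
    (D : set T) (f h : T -> R) : measurable D -> measurable_fun D f ->
  measurable_fun D h -> (\forall x \ae m, D x -> f x = h x) ->
  Rintegral m D f = Rintegral m D h.
Proof.
move=> mD mf mh fh; congr fine; apply: ae_eq_integral => //.
- exact/measurable_EFinP.
- exact/measurable_EFinP.
- by apply: filterS fh => x /[apply] /= ->.
Qed.

Section Fubini_split.
Context d (T : measurableType d) (R : realType)
  (m : {sigma_finite_measure set T -> \bar R}) (E : set (T * T)) (f h : T -> R).
Hypothesis mE : measurable E.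
Hypothesis fi : m.-integrable setT (EFin \o f).
Hypothesis hi : m.-integrable setT (EFin \o h).

Let mf : measurable_fun setT f.
Proof. exact/measurable_EFinP/(measurable_int m). Qed.

Let mh : measurable_fun setT h.
Proof. exact/measurable_EFinP/(measurable_int m). Qed.

Let k (z : T * T) := f z.1 * h z.2.

Let mk : measurable_fun setT k.
Proof. by apply: measurable_funM; apply: measurableT_comp. Qed.

(** By Tonelli the iterated integral of [|k|] factors into the product of the L1 norms of [f] and
    [h]. *)
Let ki : (m \x m)%E.-integrable setT (EFin \o k).
Proof.
apply/integrable12ltyP; first exact/measurable_EFinP.
have hn : (\int[m]_y `|h y|%:E \is a fin_num)%E.
  exact: (integrable_fin_num _ (integrable_norm hi)).
have -> : (\int[m]_x \int[m]_y `|(EFin \o k) (x, y)| =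
    \int[m]_x (`|f x|%:E * \int[m]_y `|h y|%:E))%E.
  apply: eq_integral => x _; rewrite -ge0_integralZl//.
    by apply: eq_integral => y _; rewrite /= /k normrM EFinM.
  by apply/measurable_EFinP; apply: measurableT_comp.
rewrite ge0_integralZr//=; last 2 first.
- by apply/measurable_EFinP; apply: measurableT_comp.
- by apply: integral_ge0.
by rewrite ltey_eq fin_numM//;
  apply: (integrable_fin_num _ (integrable_norm fi)).
Qed.

Lemma integrable_mul_indic (e : T -> R) (A : set T) : measurable A ->
  m.-integrable setT (EFin \o e) ->
  m.-integrable setT (fun x => (e x * \1_A x)%:E).
Proof.
move=> mA ei; apply: (le_integrable _ _ _ ei) => //.
  apply/measurable_EFinP; apply: measurable_funM => //.
  by apply/measurable_EFinP; apply: (measurable_int m).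
move=> x _; rewrite /= lee_fin normrM ler_piMr// indicE.
by case: (x \in A); rewrite ?normr1 ?normr0.
Qed.

(** Both terms are iterated integrals of [f x * h y]: over [E] with [x] integrated first, over the
    complement with [y] first. Together they fill the product, where the integral factors. *)
Lemma Fubini_split :
  [/\ m.-integrable setT (fun y => (\int[m]_x (f x * \1_E (x, y)) * h y)%R%:E),
      m.-integrable setT (fun x => (f x * \int[m]_y (h y * \1_(~` E) (x, y)))%R%:E)
    & \int[m]_y (\int[m]_x (f x * \1_E (x, y)) * h y) +
      \int[m]_x (f x * \int[m]_y (h y * \1_(~` E) (x, y))) =
      \int[m]_x f x * \int[m]_y h y].
Proof.
have mC : measurable (~` E) by exact: measurableC.
have kA A : measurable A ->
  (m \x m)%E.-integrable setT (fun z => (k z * \1_A z)%:E).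
  move=> mA; apply: le_integrable ki => //.
    by apply/measurable_EFinP; apply: measurable_funM => //.
  move=> x _; rewrite /= lee_fin normrM ler_piMr// indicE.
  by case: (x \in A); rewrite ?normr1 ?normr0.
have kE := kA _ mE; have kC := kA _ mC.
have GE : fubini_G m (fun z => (k z * \1_E z)%:E) =
    (fun y => (\int[m]_x (f x * \1_E (x, y)) * h y)%R%:E).
  apply/funext => y; rewrite /fubini_G /k /=.
  have mEy : measurable (ysection E y) by exact: measurable_ysection.
  have fE : m.-integrable setT (fun x => (f x * \1_E (x, y))%:E).
    have := integrable_mul_indic mEy fi; apply: eq_integrable => // x _.
    by rewrite !indicE mem_ysection.
  (* For fixed [y] the factor [h y] is a constant, so the inner integral is finite and passing
     through [fine] loses nothing. *)
  rewrite -RintegralZr//= /Rintegral fineK.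
    by apply: eq_integral => x _; rewrite mulrAC.
  apply: integrable_fin_num => //; have := integrableZr measurableT (h y) fE.
  by apply: eq_integrable.
have FE : fubini_F m (fun z => (k z * \1_(~` E) z)%:E) =
    (fun x => (f x * \int[m]_y (h y * \1_(~` E) (x, y)))%R%:E).
  apply/funext => x; rewrite /fubini_F /k /=.
  have mEx : measurable (xsection (~` E) x) by exact: measurable_xsection.
  have hE : m.-integrable setT (fun y => (h y * \1_(~` E) (x, y))%:E).
    have := integrable_mul_indic mEx hi; apply: eq_integrable => // y _.
    by rewrite !indicE mem_xsection.
  rewrite -RintegralZl//= /Rintegral fineK.
    by apply: eq_integral => y _; rewrite mulrA.
  apply: integrable_fin_num => //; have := integrableZl measurableT (f x) hE.
  by apply: eq_integrable.
have GEi := integrable_fubini_G kE; have FEi := integrable_fubini_F kC.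
rewrite GE in GEi; rewrite FE in FEi; split => //.
rewrite /Rintegral -fineD; [|exact: integrable_fin_num..].
rewrite -GE -FE integral21_prod_meas1// integral12_prod_meas1//.
rewrite -integralD_EFin//=.
(* The indicators of [E] and of its complement add up to one. *)
transitivity (fine (\int[(m \x m)]_z (k z)%:E)%E).
  congr fine; apply: eq_integral => z _; rewrite /= -EFinD; congr EFin.
  rewrite -mulrDr !indicE in_setC; case: (z \in E);
    rewrite /= ?addr0 ?add0r mulr1//.
rewrite -(integral12_prod_meas1 ki) /fubini_F /k /=.
rewrite -fineM; [|exact: integrable_fin_num..].
have hE := fineK (integrable_fin_num measurableT hi).
rewrite -[in RHS]hE -integralZr//; congr fine; apply: eq_integral => x _.
by rewrite hE -integralZl.
Qed.

End Fubini_split.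

(** * Measurability for the completed Stieltjes measure, and integration by parts *)

Section LS.
Context {R : realType} {a b : R} (g : derivator a b).
Local Notation LS := (caratheodory_type (R := R) (T := ocitv_type R)
  (wlength (derivator_right g))^*%mu).

Lemma borel_LS_measurable (A : set R) :
  measurable (A : set (measurableTypeR R)) -> measurable (A : set LS).
Proof.
exact: (sub_caratheodory (wlength (derivator_right g) : {measure set _ -> \bar R})).
Qed.

Lemma LS_measurable_itv (i : interval R) : measurable ([set` i] : set LS).
Proof. by apply: borel_LS_measurable; apply: measurable_itv. Qed.
#[local] Hint Resolve LS_measurable_itv : core.

Lemma LS_measurable_id D : measurable_fun (D : set LS) (fun t : LS => t : R).
Proof.
by move=> mD Y mY; apply: measurableI => //; exact: borel_LS_measurable.
Qed.

Lemma mu_g_fin (A : set LS) : a <= b -> A `<=` `[a, b[ -> measurable A ->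
  (mu_g g A < +oo)%E.
Proof.
move=> ab AD mA.
apply: (@le_lt_trans _ _ (mu_g g `[a, b[%classic));
  last by rewrite mu_g_itvco// ltry.
by apply: le_measure => //; rewrite inE//; exact: LS_measurable_itv.
Qed.

(** Preimage of []0, +oo[] under the difference of the coordinates. *)
Lemma LS_measurable_lt : measurable [set z : LS * LS | (z.1 : R) < (z.2 : R)].
Proof.
have m1 : measurable_fun setT (fun z : LS * LS => z.1 : R).
  by apply: (measurableT_comp (f := fun t : LS => t : R)) => //;
    exact: LS_measurable_id.
have m2 : measurable_fun setT (fun z : LS * LS => z.2 : R).
  by apply: (measurableT_comp (f := fun t : LS => t : R)) => //;
    exact: LS_measurable_id.
have := measurable_funB m2 m1 measurableT (measurable_itv `]0, +oo[).
rewrite setTI; congr measurable; apply/seteqP; split=> z /=;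
  by rewrite in_itv/= andbT subr_gt0.
Qed.

Local Notation integrable_on c f :=
  ((mu_g g).-integrable `[a, c[%classic (EFin \o (f : LS -> R))).

(** [Fubini_split] along [x < y], for [f] and [h] cut off outside [[a, c[]. The section at [y] is
    [[a, y[]; the complement [y <= x] has section [[a, x]], so the diagonal, which carries the
    atoms, goes to the second integral. *)
Lemma Rintegral_by_parts (c : R) (f h : R -> R) :
  integrable_on c f -> integrable_on c h ->
  [/\ integrable_on c (fun t => Rintegral (mu_g g) `[a, t[%classic f * h t),
      integrable_on c (fun t => f t * Rintegral (mu_g g) `[a, t]%classic h)
    & Rintegral (mu_g g) `[a, c[%classic
        (fun t => Rintegral (mu_g g) `[a, t[%classic f * h t) +
      Rintegral (mu_g g) `[a, c[%classic
        (fun t => f t * Rintegral (mu_g g) `[a, t]%classic h) =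
      Rintegral (mu_g g) `[a, c[%classic f * Rintegral (mu_g g) `[a, c[%classic h].
Proof.
move=> fi hi; set D : set LS := `[a, c[%classic.
have mD : measurable D := LS_measurable_itv `[a, c[.
have fDi : (mu_g g).-integrable setT (EFin \o (f \_ D)).
  by rewrite -restrict_EFin; apply: (integrable_mkcond _ mD).1.
have hDi : (mu_g g).-integrable setT (EFin \o (h \_ D)).
  by rewrite -restrict_EFin; apply: (integrable_mkcond _ mD).1.
have [i1 i2 eq12] := Fubini_split LS_measurable_lt fDi hDi.
set E := [set z | _] in i1 i2 eq12.
have FE y : Rintegral (mu_g g) setT (fun x => (f \_ D) x * \1_E (x, y)) * (h \_ D) y
    = ((fun t : LS => Rintegral (mu_g g) `[a, t[%classic f * h t) \_ D) y.
  rewrite [in LHS]patchE [in RHS]patchE; case: ifPn => [|_];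
    last by rewrite mulr0.
  rewrite inE /D/= in_itv/= => /andP[ay yc].
  congr (_ * _); rewrite [RHS]Rintegral_mkcond; apply: eq_Rintegral => x _.
  rewrite !patchE indicE; have [xy|yx] := ltP x y.
    rewrite (@mem_set _ E)//= mulr1; congr (if _ then _ else _).
    by apply/idP/idP; rewrite !inE /D/= !in_itv/= xy (lt_trans xy yc).
  rewrite (@memNset _ E) ?mulr0; last by rewrite /E/=; apply/negP;
    rewrite -leNgt.
  by rewrite memNset//= in_itv/= (ltNge _ y) yx andbF.
have HE x : (f \_ D) x * Rintegral (mu_g g) setT (fun y => (h \_ D) y * \1_(~` E) (x, y))
    = ((fun t : LS => f t * Rintegral (mu_g g) `[a, t]%classic h) \_ D) x.
  rewrite [in LHS]patchE [in RHS]patchE; case: ifPn => [|_];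
    last by rewrite mul0r.
  rewrite inE /D/= in_itv/= => /andP[ax xc].
  congr (_ * _); rewrite [RHS]Rintegral_mkcond; apply: eq_Rintegral => y _.
  rewrite !patchE indicE in_setC; have [xy|yx] := ltP x y.
    rewrite (@mem_set _ E)//= mulr0.
    by rewrite memNset//= in_itv/= (leNgt _ x) xy andbF.
  rewrite (@memNset _ E) ?mulr1; last by rewrite /E/=; apply/negP;
    rewrite -leNgt.
  congr (if _ then _ else _).
  by apply/idP/idP; rewrite !inE /D/= !in_itv/= yx (le_lt_trans yx xc).
split.
- apply: (integrable_mkcond _ mD).2; rewrite restrict_EFin.
  by apply: eq_integrable i1 => // y _; rewrite /= FE.
- apply: (integrable_mkcond _ mD).2; rewrite restrict_EFin.
  by apply: eq_integrable i2 => // x _; rewrite /= HE.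
- rewrite 4!(Rintegral_mkcond _ D) -eq12; congr (_ + _);
    apply: eq_Rintegral => x _.
    by rewrite FE.
  by rewrite HE.
Qed.

End LS.

(** * Primitives of real functions: vanishing, absolute continuity, right limits and atoms *)

Section Primitives.
Context {R : realType} {a b : R} (g : derivator a b).
Local Notation LS := (caratheodory_type (R := R) (T := ocitv_type R)
  (wlength (derivator_right g))^*%mu).
Local Notation integrable_on c f :=
  ((mu_g g).-integrable `[a, c[%classic (EFin \o (f : LS -> R))).
#[local] Hint Resolve LS_measurable_itv : core.

(* The library's hint for this class does not find the measure structure of
   [mu_g g]. *)
#[global] Instance ae_mu_g_filter : Filter (almost_everywhere (mu_g g)).
Proof. exact: (ae_filter_ringOfSetsType (mu_g g)). Qed.

Lemma integrable_on_measurable c f : integrable_on c f ->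
  measurable_fun (`[a, c[%classic : set LS) f.
Proof.
by move=> fi; apply/measurable_EFinP; apply: (measurable_int (mu_g g)).
Qed.

Lemma integrable_onW c t f : integrable_on c f -> t <= c -> integrable_on t f.
Proof.
move=> fi tc; apply: integrableS fi => //; apply: subset_itvl.
by rewrite bnd_simp.
Qed.

Lemma integrable_on_cc c t f : integrable_on c f -> t < c ->
  (mu_g g).-integrable `[a, t]%classic (EFin \o (f : LS -> R)).
Proof.
move=> fi tc; apply: integrableS fi => //; apply: subset_itvl.
by rewrite bnd_simp.
Qed.

Lemma Rintegral_itvcc c t f : integrable_on c f -> a <= t -> t < c ->
  Rintegral (mu_g g) `[a, t]%classic f =
  Rintegral (mu_g g) `[a, t[%classic f + f t * fine (mu_g g [set t]).
Proof.
move=> fi at_ tc.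
have m1 : measurable ([set t] : set LS) by rewrite -set_itv1;
  exact: LS_measurable_itv.
have tE : `[a, t]%classic = `[a, t[%classic `|` [set t] by rewrite setUitv1.
rewrite tE (Rintegral_setU (LS_measurable_itv _ _) m1); last 2 first.
- by rewrite -tE; exact: integrable_on_cc tc.
- apply/disj_setPS => x /= [/[swap] ->]; rewrite in_itv/= ltxx andbF//.
congr (_ + _); rewrite -(Rintegral_cst _ m1); apply: eq_Rintegral => x.
by rewrite inE => ->.
Qed.

(** Passes from almost everywhere to everywhere, including points of intervals where [g] is
    constant. The square of the primitive is itself the primitive of a nonnegative function, hence
    nondecreasing, and it is zero at [b]. *)
Lemma primitive_ae0 f : a <= b -> integrable_on b f ->
  (\forall t \ae mu_g g, `[a, b[%classic t -> Rintegral (mu_g g) `[a, t[%classic f = 0) ->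
  Rintegral (mu_g g) `[a, b[%classic f = 0 ->
  forall t, a <= t -> t <= b -> Rintegral (mu_g g) `[a, t[%classic f = 0.
Proof.
move=> ab fi W0 Wb0.
pose W (t : LS) := Rintegral (mu_g g) `[a, t[%classic f.
pose V (t : LS) := f t * Rintegral (mu_g g) `[a, t]%classic f.
have Wae c : c <= b -> \forall t \ae mu_g g, `[a, c[%classic t -> W t = 0.
  move=> cb; apply: filterS W0 => t H tc; apply: H; apply: subset_itvl tc.
  by rewrite bnd_simp.
have Vi c : c <= b -> integrable_on c V.
  by move=> cb; have fc := integrable_onW fi cb;
    have [] := Rintegral_by_parts fc fc.
(* [V] is nonnegative only almost everywhere; its positive part is so at every point, as the
   comparison of integrals over nested intervals requires. *)
pose P t := Num.max 0 (V t).
have Pi c : c <= b -> integrable_on c P.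
  move=> cb; apply: eq_integrable (integrable_funrpos _ (Vi _ cb)) => // t _ /=.
  by rewrite /P maxC.
have VP c : c <= b -> Rintegral (mu_g g) `[a, c[%classic V =
    Rintegral (mu_g g) `[a, c[%classic P.
  move=> cb; apply: ae_eq_Rintegral => //.
  - exact/integrable_on_measurable/Vi.
  - exact/integrable_on_measurable/Pi.
  apply: filterS (Wae c cb) => t Wt tc; have {}Wt := Wt tc.
  rewrite /P max_r// /V; move: tc; rewrite /= in_itv/= => /andP[at_ tc].
  (* As [W t = 0], only the atom at [t] remains, and [V t] is the square of [f t] times the mass of
     [t]. *)
  rewrite (Rintegral_itvcc fi)// ?(lt_le_trans tc)//.
  rewrite -/(W t) Wt add0r mulrA mulr_ge0// ?fine_ge0// -expr2 sqr_ge0//.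
have W2 c : c <= b -> W c ^+ 2 = Rintegral (mu_g g) `[a, c[%classic P.
  move=> cb; have fc := integrable_onW fi cb.
  have [Wfi _ +] := Rintegral_by_parts fc fc.
  have Wf0 : Rintegral (mu_g g) `[a, c[%classic (fun t => W t * f t) = 0.
    rewrite -[RHS](mul0r (fine (mu_g g `[a, c[%classic))) -Rintegral_cst//.
    apply: ae_eq_Rintegral; [exact: LS_measurable_itv|
      exact: integrable_on_measurable Wfi|exact: measurable_cst|].
    by apply: filterS (Wae c cb) => t Wt tc; rewrite Wt// mul0r.
  by rewrite -/(V _) -/(W c) Wf0 add0r expr2 => <-; rewrite VP.
move=> t at_ tb; apply/eqP; rewrite -sqrf_eq0 -/(W t) W2//.
rewrite eq_le Rintegral_ge0 ?andbT; last by move=> x _; rewrite le_max lexx.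
(* The upper bound zero is rewritten as the integral of [P] over the larger interval [[a, b[], equal
   to the square of [W b]. *)
have <- : Rintegral (mu_g g) `[a, b[%classic P = 0
  by rewrite -W2// /W Wb0 expr0n.
rewrite fine_le//; try exact: integrable_fin_num.
  by apply: integrable_fin_num => //; exact: Pi.
  by apply: integrable_fin_num => //; exact: Pi.
apply: ge0_subset_integral; [exact: LS_measurable_itv..| | |].
- by apply/measurable_EFinP/integrable_on_measurable/Pi.
- by move=> x _; rewrite lee_fin le_max lexx.
- by apply: subset_itvl; rewrite bnd_simp.
Qed.

(** Absolute continuity of the integral on the whole line, applied to [f] cut off outside [[a,
    b[]. *)
Lemma integral_abs_continuous f : integrable_on b f -> forall e, 0 < e ->
  exists2 r : R, 0 < r & forall A : set LS, measurable A -> A `<=` `[a, b[ ->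
    (mu_g g A < r%:E)%E -> Rintegral (mu_g g) A (fun t => `|f t|) < e.
Proof.
move=> fi e e0; set D : set LS := `[a, b[%classic.
have mD : measurable D := LS_measurable_itv g `[a, b[.
have fDi : (mu_g g).-integrable setT (EFin \o (f \_ D)).
  by rewrite -restrict_EFin; apply: (integrable_mkcond _ mD).1.
have [r [r0 H]] := integral_normr_continuous fDi e0.
exists r => // A mA AD Ar; apply: le_lt_trans (H _ mA Ar).
rewrite le_eqVlt; apply/orP; left; apply/eqP; apply: eq_Rintegral => x.
by rewrite inE => /AD Dx; rewrite patchE mem_set.
Qed.

(** Dynkin's theorem: the half-lines []-oo, x[] are stable under intersection and generate the Borel
    sets, on them the integral is a value of the primitive, and the sets of zero integral are stable
    under complement and disjoint countable union. *)
Lemma primitive0_Borel f : a <= b -> integrable_on b f ->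
  (forall t, a <= t -> t <= b -> Rintegral (mu_g g) `[a, t[%classic f = 0) ->
  forall B : set (measurableTypeR R), measurable B ->
    (\int[mu_g g]_(x in (B `&` `[a, b[%classic : set LS)) (f x)%:E = 0)%E.
Proof.
move=> ab fi W0.
have mBD (B : set (measurableTypeR R)) : measurable B ->
    measurable (B `&` `[a, b[%classic : set LS).
  by move=> mB; apply: measurableI;
    [exact: borel_LS_measurable|exact: LS_measurable_itv].
have W0E t : a <= t -> t <= b ->
  (\int[mu_g g]_(x in `[a, t[%classic) (f x)%:E = 0)%E.
  move=> at_ tb; rewrite -[LHS]fineK; first by congr EFin; exact: W0.
  by apply: integrable_fin_num => //; exact: integrable_onW tb.
pose P : set_system (measurableTypeR R) := fun B =>
  (\int[mu_g g]_(x in (B `&` `[a, b[%classic : set LS)) (f x)%:E = 0)%E.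
move=> B mB; rewrite -/(P B); have : <<s @RGenInftyO.G R >> B.
  by rewrite -[<<s _ >>]RGenInftyO.measurableE.
move: B {mB}; apply: dynkin_induction; rewrite {}/P.
- exact: RGenInftyO.measurableE.
- move=> _ _ [x ->] [y ->]; exists (Num.min x y).
  by apply/seteqP; split=> z /=; rewrite !in_itv/= lt_min => /andP.
- by rewrite /= setTI W0E.
- move=> _ [x ->] /=; have [xa|ax] := leP x a.
    rewrite [X in integral _ X](_ : _ = set0) ?integral_set0//.
    apply/seteqP; split=> // z [] /=; rewrite !in_itv/= => zx /andP[az _].
    by have := lt_le_trans zx (le_trans xa az); rewrite ltxx.
  rewrite [X in integral _ X](_ : _ = `[a, Num.min x b[%classic).
    by rewrite W0E// ?le_min ?(ltW ax)// ge_min lexx orbT.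
  apply/seteqP; split=> z /=; rewrite !in_itv/= lt_min.
    by move=> [-> /andP[-> ->]].
  by move=> /and3P[-> -> ->].
- move=> S mS /= S0.
  have := W0E b ab (lexx b).
  have DE : `[a, b[%classic = (S `&` `[a, b[%classic) `|` (~` S `&` `[a, b[%classic).
    by rewrite -setIUl setUv setTI.
  rewrite {1}DE integral_setU//=.
  + by rewrite S0 add0e.
  + exact: mBD.
  + by apply: mBD; exact: measurableC.
  + by rewrite -DE; exact: (measurable_int (mu_g g) fi).
  + by apply/disj_setPS => x [[? _] []].
- move=> F mF tF F0 /=; rewrite setI_bigcupl integral_bigcup.
  + by rewrite eseries0// => i _ _; exact: F0.
  + exact: trivIset_setIr.
  + by move=> k; exact: mBD.
  + rewrite -setI_bigcupl; apply: integrableS fi => //.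
    by apply: mBD; exact: bigcupT_measurable.
Qed.

(** [mu_g] is the outer measure built from half-open intervals, so a nearly optimal countable cover
    by such intervals has a Borel union of barely larger measure. *)
Lemma LS_Borel_cover (A : set LS) (e : R) : (mu_g g A < +oo)%E -> 0 < e ->
  exists V : set (measurableTypeR R), [/\ measurable V, A `<=` V
    & (mu_g g V < mu_g g A + e%:E)%E].
Proof.
move=> Afin e0.
pose m : {measure set (ocitv_type R) -> \bar R} := wlength (derivator_right g).
have Afn : mu_g g A \is a fin_num by rewrite ge0_fin_numE.
have : (m^*)%mu A \is a fin_num by exact: Afn.
move=> /lb_ereal_inf_adherent -/(_ _ e0)[_ /= [F [mF AF] <-] Fe].
exists (\bigcup_k F k); split => //.
  by apply: bigcupT_measurable => k; apply: sub_sigma_algebra; exact: mF.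
apply: le_lt_trans Fe.
apply: (le_trans (outer_measure_sigma_subadditive (m^*)%mu F)).
by apply: lee_nneseries => // n _; rewrite -((measurable_mu_extE m) (F n)).
Qed.

(** It suffices that the integral over each measurable [A] vanishes. A Borel set [V] covers [A] with
    small excess; the integral over [V] within [[a, b[] is zero, so the integral over [A] is
    opposite to the one over the excess, which is small by absolute continuity. *)
Lemma primitive0_ae0 f : a <= b -> integrable_on b f ->
  (forall t, a <= t -> t <= b -> Rintegral (mu_g g) `[a, t[%classic f = 0) ->
  \forall t \ae mu_g g, `[a, b[%classic t -> f t = 0.
Proof.
move=> ab fi W0.
have mD : measurable (`[a, b[%classic : set LS) by exact: LS_measurable_itv.
have : ae_eq (mu_g g) `[a, b[%classic (EFin \o (f : LS -> R)) (cst 0%E).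
  apply: (integral_ae_eq mD fi) => //.
  move=> A AD mA; rewrite integral_cst// mul0e.
  have fA : (mu_g g).-integrable A (EFin \o (f : LS -> R))
    by exact: integrableS fi.
  rewrite -[LHS]fineK; last exact: integrable_fin_num.
  congr EFin; change (Rintegral (mu_g g) A f = 0).
  apply/eqP; rewrite -normr_le0; apply/ler_addgt0Pl => e e0.
  rewrite addr0.
  have [r r0 H] := integral_abs_continuous fi e0.
  have Afin := mu_g_fin ab AD mA.
  have [V [mV AV Vr]] := LS_Borel_cover Afin r0.
  have mV' := borel_LS_measurable g mV.
  pose B : set LS := (V `&` `[a, b[%classic) `\` A.
  have mVD : measurable (V `&` `[a, b[%classic : set LS) by exact: measurableI.
  have mB : measurable B by exact: measurableD.
  have BD : B `<=` `[a, b[ by move=> x [[]].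
  have Br : (mu_g g B < r%:E)%E.
    apply: (@le_lt_trans _ _ (mu_g g (V `\` A))).
      apply: le_measure; rewrite ?inE//; first exact: measurableD.
      by move=> x [[]].
    rewrite measureD//; last by apply: lt_trans Vr _;
      rewrite lte_add_pinfty// ltry.
    rewrite setIidr// lteBlDr// 1?addeC// ge0_fin_numE//.
  have fB : (mu_g g).-integrable B (EFin \o (f : LS -> R))
    by exact: integrableS fi.
  have := primitive0_Borel ab fi W0 mV.
  have VE : V `&` `[a, b[%classic = A `|` B.
    by rewrite /B setDE setUIr setUv setIT setUidr// => x Ax; split;
      [exact: AV|exact: AD].
  rewrite VE => /(congr1 fine); rewrite -/(Rintegral _ _ _) Rintegral_setU//;
    last first.
  - by apply/disj_setPS => x [Ax []].
  - by rewrite -VE; apply: integrableS fi => // x [].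
  move/eqP; rewrite addr_eq0 => /eqP ->; rewrite normrN.
  by apply: le_trans (le_normr_Rintegral mB fB) _; apply/ltW; exact: H.
by apply: filterS => t /[apply] -[].
Qed.

(** The intervals [I n] decrease to the empty set, so continuity from above applies. The open left
    end keeps the atom at [t] out, and the factor [b - t] keeps the right ends below [b]. *)
Lemma mu_g_oo_small t r : a <= t -> t < b -> 0 < r ->
  exists2 s, t < s & s <= b /\ (mu_g g `]t, s[%classic < r%:E)%E.
Proof.
move=> at_ tb r0.
pose I (n : nat) : set LS := `]t, t + (b - t) * n.+1%:R^-1[%classic.
have I0 : \bigcap_n I n = set0.
  apply/seteqP; split => // x /= Ix.
  have tx : t < x by have := Ix 0%N Logic.I; rewrite /I/= in_itv/= => /andP[].
  (* Once the inverse of [n + 1] is below this ratio, [x] lies to the right of [I n]. *)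
  have d0 : 0 < (b - t)^-1 * (x - t) by rewrite mulr_gt0 ?invr_gt0 ?subr_gt0.
  near \oo => n; have := Ix n Logic.I; rewrite /I/= in_itv/= => /andP[_].
  apply/negP; rewrite -leNgt -lerBrDl -ler_pdivlMl ?subr_gt0//.
  by apply: ltW; near: n; exact: (near_infty_natSinv_lt (PosNum d0)).
have mI n : measurable (I n) by exact: LS_measurable_itv.
have Ile m n : (n <= m)%N -> I m `<=` I n.
  move=> nm; apply: subset_itvl; rewrite bnd_simp lerD2l ler_pM2l ?subr_gt0//.
  by rewrite lef_pV2 ?posrE// ler_nat.
have Ib n : t + (b - t) * n.+1%:R^-1 <= b.
  by rewrite -lerBrDl ler_piMr ?subr_ge0 ?(ltW tb)// invf_le1// ler1n.
have : (mu_g g \o I) n @[n --> \oo] --> mu_g g (\bigcap_n I n).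
  apply: nonincreasing_cvg_mu => //.
  - apply: mu_g_fin => //; first by rewrite (le_trans at_ (ltW tb)).
    move=> x; rewrite /I /= !in_itv/= => /andP[tx xb].
    by rewrite (le_trans at_ (ltW tx)) (lt_le_trans xb (Ib _)).
  - by rewrite I0.
  - by move=> m n mn; apply/subsetPset; exact: Ile.
rewrite I0 measure0 => /fine_cvgP[Ifin /cvgrPdist_lt/(_ _ r0) Ir].
near \oo => n; exists (t + (b - t) * n.+1%:R^-1).
  by rewrite ltrDl mulr_gt0 ?subr_gt0.
split=> //; rewrite -/(I n).
have Inf : mu_g g (I n) \is a fin_num by near: n; exact: Ifin.
rewrite -(fineK Inf) lte_fin.
have : `|0 - fine (mu_g g (I n))| < r by near: n; exact: Ir.
by rewrite sub0r normrN ger0_norm ?fine_ge0.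
Unshelve. all: by end_near. Qed.

(** The difference is an integral over []t, s[], an interval of small measure for [s] close to [t].
    The right limit of the primitive thus includes the atom at [t]. *)
Lemma primitive_right_limit f t : a <= t -> t < b -> integrable_on b f ->
  forall e, 0 < e -> \forall s \near t^'+,
    `|Rintegral (mu_g g) `[a, s[%classic f - Rintegral (mu_g g) `[a, t]%classic f| < e.
Proof.
move=> at_ tb fi e e0.
have [r r0 H] := integral_abs_continuous fi e0.
have [s0 ts0 [s0b s0r]] := mu_g_oo_small at_ tb r0.
near=> s.
have ts : t < s by near: s; exact: nbhs_right_gt.
have ss0 : s < s0 by near: s; exact: nbhs_right_lt.
have sb : s < b by exact: lt_le_trans s0b.
have sE : `[a, s[%classic = `[a, t]%classic `|` `]t, s[%classic.
  by rewrite -itv_bndbnd_setU// ?bnd_simp.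
have sub : `]t, s[ `<=` `[a, b[.
  move=> x /=; rewrite !in_itv/= => /andP[tx xs].
  by rewrite (le_trans at_ (ltW tx)) (lt_trans xs).
have mcc : measurable (`[a, t]%classic : set LS) by exact: LS_measurable_itv.
have moo : measurable (`]t, s[%classic : set LS) by exact: LS_measurable_itv.
have foo : (mu_g g).-integrable (`]t, s[%classic : set LS) (EFin \o (f : LS -> R)).
  exact: integrableS fi.
rewrite sE (Rintegral_setU mcc moo); last 2 first.
- by rewrite -sE; exact: integrable_onW (ltW sb).
- by apply/disj_setPS => x /=; rewrite !in_itv/= => -[/andP[_ xt] /andP[]];
    rewrite ltNge xt.
rewrite addrAC subrr add0r; apply: le_lt_trans (le_normr_Rintegral moo foo) _.
apply: H => //; apply: le_lt_trans s0r; apply: le_measure; rewrite ?inE//.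
by apply: subset_itvl; rewrite bnd_simp ltW.
Unshelve. all: by end_near. Qed.

(** Since [t] belongs to [[t, s[], its mass is at most [g s - g t] for every [s > t] up to [b];
    letting [s] decrease to [t] bounds it by the jump, which is not positive. *)
Lemma mu_g_set1_nonjump t : a <= t -> t < b -> ~ jump_set g t ->
  fine (mu_g g [set t]) = 0.
Proof.
move=> at_ tb nj.
have m1 : measurable ([set t] : set LS) by rewrite -set_itv1;
  exact: LS_measurable_itv.
have ab : a <= b by rewrite (le_trans at_ (ltW tb)).
have m1fin : mu_g g [set t] \is a fin_num.
  rewrite ge0_fin_numE//; apply: mu_g_fin => // x ->/=.
  by rewrite in_itv/= at_ tb.
apply/eqP; rewrite eq_le fine_ge0// andbT.
(* To the right of [t] and before [b], [g] agrees with its monotone extension, whose right limits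
   exist. *)
have gcvg : g s @[s --> t^'+] --> derivator_right g t.
  have := @derivator_right_cvg _ _ _ g t.
  apply: cvg_trans; apply: near_eq_cvg; near=> s.
  apply: derivator_extE; rewrite in_itv/=; apply/andP; split.
    apply: le_trans at_ _; near: s; exact: nbhs_right_ge.
  by near: s; exact: nbhs_right_le.
have jumpE : jump g t = derivator_right g t - g t.
  by rewrite /jump (cvg_lim _ gcvg).
have : jump g t <= 0.
  by rewrite leNgt; apply/negP => j0; apply: nj; split => //;
    rewrite in_itv/= at_.
apply: le_trans; rewrite jumpE lerBrDr.
rewrite -(cvg_lim _ gcvg)//; apply: limr_ge; first by apply/cvg_ex; eexists;
  exact: gcvg.
near=> s.
have ts : t < s by near: s; exact: nbhs_right_gt.
have sb : s <= b by near: s; exact: nbhs_right_le.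
rewrite -lerBrDr -lee_fin fineK// -mu_g_itvco// ?(ltW ts)//.
apply: (le_measure (mu_g g)); rewrite ?inE//.
by move=> x ->/=; rewrite in_itv/= lexx.
Unshelve. all: by end_near. Qed.

End Primitives.

(** * Real and imaginary parts, uniformly in the two scalar fields *)

Section ScalarTheory.
Context {R : realType} {k : scalar_kind}.
Local Notation F := (scalar_field R k).
Implicit Types x y z : F.

Lemma scalar_ext x y : scalar_re x = scalar_re y ->
  scalar_im x = scalar_im y -> x = y.
Proof. by case: k x y => //= -[x1 x2] [y1 y2] /= -> ->. Qed.

Lemma scalar_reD x y : scalar_re (x + y) = scalar_re x + scalar_re y.
Proof. by case: k x y => //= -[x1 x2] [y1 y2]. Qed.

Lemma scalar_imD x y : scalar_im (x + y) = scalar_im x + scalar_im y.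
Proof. by case: k x y => /= [x y|[x1 x2] [y1 y2]//]; rewrite addr0. Qed.

Lemma scalar_reN x : scalar_re (- x) = - scalar_re x.
Proof. by case: k x => //= -[x1 x2]. Qed.

Lemma scalar_imN x : scalar_im (- x) = - scalar_im x.
Proof. by case: k x => /= [x|[x1 x2]//]; rewrite oppr0. Qed.

Lemma scalar_reM x y :
  scalar_re (x * y) = scalar_re x * scalar_re y - scalar_im x * scalar_im y.
Proof. by case: k x y => /= [x y|[x1 x2] [y1 y2]//]; rewrite mul0r subr0. Qed.

Lemma scalar_imM x y :
  scalar_im (x * y) = scalar_re x * scalar_im y + scalar_im x * scalar_re y.
Proof.
by case: k x y => /= [x y|[x1 x2] [y1 y2]//]; rewrite mulr0 mul0r addr0.
Qed.

Lemma scalar_re0 : scalar_re (0 : F) = 0. Proof. by case: k. Qed.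
Lemma scalar_im0 : scalar_im (0 : F) = 0. Proof. by case: k. Qed.
Lemma scalar_re1 : scalar_re (1 : F) = 1. Proof. by case: k. Qed.
Lemma scalar_im1 : scalar_im (1 : F) = 0. Proof. by case: k. Qed.

Lemma scalar_re_mk r i : scalar_re (mk_scalar r i : F) = r.
Proof. by case: k. Qed.

(** Stated for second argument zero because, with real scalars, [mk_scalar] discards that
    argument. *)
Lemma scalar_im_mk0 r : scalar_im (mk_scalar r 0 : F) = 0.
Proof. by case: k. Qed.

Lemma scalar_abs_ge0 x : 0 <= scalar_abs x.
Proof.
rewrite /scalar_abs; case: k x => /= [x|[x1 x2]]; first exact: normr_ge0.
exact: sqrtr_ge0.
Qed.

Lemma scalar_re_le_abs x : `|scalar_re x| <= scalar_abs x.
Proof.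
rewrite /scalar_abs; case: k x => //= -[x1 x2] /=.
by rewrite -sqrtr_sqr ler_wsqrtr// lerDl sqr_ge0.
Qed.

Lemma scalar_im_le_abs x : `|scalar_im x| <= scalar_abs x.
Proof.
rewrite /scalar_abs; case: k x => /= [x|[x1 x2]] /=; first by rewrite normr0.
by rewrite -sqrtr_sqr ler_wsqrtr// lerDr sqr_ge0.
Qed.

Lemma scalar_abs_le x : scalar_abs x <= `|scalar_re x| + `|scalar_im x|.
Proof.
rewrite /scalar_abs; case: k x => /= [x|[x1 x2]] /=;
  first by rewrite normr0 addr0.
rewrite -[leRHS]ger0_norm ?addr_ge0// -sqrtr_sqr ler_wsqrtr//.
by rewrite sqrrD !real_normK ?num_real// lerD2r lerDl mulrn_wge0// mulr_ge0.
Qed.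

(** The order of the complex numbers compares only numbers with equal imaginary parts. Positivity
    forces [e] to be real, so a strict inequality in [R] lifts to the norm with values in [F]. *)
Lemma scalar_norm_lt x (e : F) : 0 < e -> scalar_abs x < scalar_re e ->
  `|x| < e.
Proof.
rewrite /scalar_abs; case: k x e => //= -[x1 x2] [e1 e2] /=.
by rewrite !ltcE /= => /andP[/eqP -> _] ->; rewrite eqxx.
Qed.

Lemma scalar_re_gt0 (e : F) : 0 < e -> 0 < scalar_re e.
Proof. by case: k e => //= -[e1 e2]; rewrite ltcE => /andP[]. Qed.

End ScalarTheory.

(** * Integration of scalar functions by components *)

Section ScalarIntegral.
Context {R : realType} {k : scalar_kind} {a b : R} (g : derivator a b).
Local Notation F := (scalar_field R k).
Local Notation LS := (caratheodory_type (R := R) (T := ocitv_type R)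
  (wlength (derivator_right g))^*%mu).
Local Notation integrable_on c f :=
  ((mu_g g).-integrable `[a, c[%classic (EFin \o (f : LS -> R))).
#[local] Hint Resolve LS_measurable_itv : core.
Implicit Types (f h : R -> F) (D : set LS).

Definition integrable_g D f :=
  (mu_g g).-integrable D (fun t => (scalar_re (f t))%:E) /\
  (mu_g g).-integrable D (fun t => (scalar_im (f t))%:E).

Lemma scalar_absE (z : F) : scalar_abs z = Num.sqrt (scalar_re z ^+ 2 + scalar_im z ^+ 2).
Proof.
rewrite /scalar_abs; case: k z => /= [x|[x y]] //.
by rewrite expr0n addr0 sqrtr_sqr.
Qed.

Lemma measurable_scalar_abs f : LS_measurable g f ->
  measurable_fun (`[a, b[%classic : set LS) (fun t => scalar_abs (f t)).
Proof.
move=> [mre mim].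
have -> : (fun t => scalar_abs (f t)) =
    Num.sqrt \o (fun t => scalar_re (f t) ^+ 2 + scalar_im (f t) ^+ 2).
  by apply/funext => t /=; exact: scalar_absE.
apply: measurableT_comp.
  by apply: continuous_measurable_fun; apply: sqrt_continuous.
by apply: measurable_funD; apply: measurable_funX.
Qed.

(** Domination in both directions: each component is bounded by the modulus, and the modulus by the
    sum of the absolute values of the components. *)
Lemma L1_gP f : L1_g g f <-> integrable_g `[a, b[%classic f.
Proof.
have mD : measurable (`[a, b[%classic : set LS) := LS_measurable_itv g `[a, b[.
split.
- move=> [mf foo]; have mabs := measurable_scalar_abs mf; case: mf => mre mim.
  have absi : integrable_on b (fun t => scalar_abs (f t)).
    apply/integrableP; split; first exact/measurable_EFinP.
    rewrite [X in (X < _)%E](_ : _ =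
      \int[mu_g g]_(t in `[a, b[%classic) (scalar_abs (f t))%:E)%E//.
    by apply: eq_integral => t _; rewrite /= ger0_norm ?scalar_abs_ge0.
  split; apply: (le_integrable mD _ _ absi); (try exact/measurable_EFinP);
    move=> t _; rewrite /= lee_fin [leRHS]ger0_norm ?scalar_abs_ge0//.
    exact: scalar_re_le_abs.
  exact: scalar_im_le_abs.
- move=> [fre fim].
  have mf : LS_measurable g f.
    by split; [exact: integrable_on_measurable fre|exact: integrable_on_measurable fim].
  split=> //; apply: (integrable_lty mD).
  apply: (le_integrable mD _ _ (integrableD mD (integrable_abse fre) (integrable_abse fim))).
    exact/measurable_EFinP/measurable_scalar_abs.
  move=> t _; rewrite /= lee_fin ger0_norm ?scalar_abs_ge0// ger0_norm ?addr_ge0//.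
  exact: scalar_abs_le.
Qed.

Lemma scalar_re_integral D f :
  scalar_re (integral_g g D f) = Rintegral (mu_g g) D (fun t => scalar_re (f t)).
Proof. by rewrite scalar_re_mk. Qed.

(** With real scalars the second component is dropped by [mk_scalar], and the right side is the
    integral of zero. *)
Lemma scalar_im_integral D f :
  scalar_im (integral_g g D f) = Rintegral (mu_g g) D (fun t => scalar_im (f t)).
Proof.
rewrite /integral_g; case: k f => //= f.
by rewrite /Rintegral integral0.
Qed.

Lemma eq_integral_g D f h : {in D, f =1 h} ->
  integral_g g D f = integral_g g D h.
Proof.
move=> fh; apply: scalar_ext; rewrite ?scalar_re_integral ?scalar_im_integral;
  by apply: eq_Rintegral => t tD; rewrite fh.
Qed.

Lemma integrable_gD D f h : measurable D -> integrable_g D f ->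
  integrable_g D h ->
  integrable_g D (fun t => f t + h t).
Proof.
move=> mD [fr fi] [hr hi]; split.
- apply: eq_integrable (integrableD mD fr hr) => // t _.
  by rewrite scalar_reD.
- apply: eq_integrable (integrableD mD fi hi) => // t _.
  by rewrite scalar_imD.
Qed.

Lemma integrable_gZ D c f : measurable D -> integrable_g D f ->
  integrable_g D (fun t => c * f t).
Proof.
move=> mD [fr fi]; split.
- apply: eq_integrable (integrableB mD (integrableZl mD (scalar_re c) fr)
    (integrableZl mD (scalar_im c) fi)) => // t _.
  by rewrite scalar_reM.
- apply: eq_integrable (integrableD mD (integrableZl mD (scalar_re c) fi)
    (integrableZl mD (scalar_im c) fr)) => // t _.
  by rewrite scalar_imM.
Qed.

Lemma integral_gD D f h : measurable D -> integrable_g D f ->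
  integrable_g D h ->
  integral_g g D (fun t => f t + h t) = integral_g g D f + integral_g g D h.
Proof.
move=> mD [fr fi] [hr hi]; apply: scalar_ext.
- rewrite scalar_reD !scalar_re_integral -RintegralD//.
  by apply: eq_Rintegral => t _; rewrite scalar_reD.
- rewrite scalar_imD !scalar_im_integral -RintegralD//.
  by apply: eq_Rintegral => t _; rewrite scalar_imD.
Qed.

Lemma integral_gZ D c f : measurable D -> integrable_g D f ->
  integral_g g D (fun t => c * f t) = c * integral_g g D f.
Proof.
move=> mD [fr fi].
have Zr r : (mu_g g).-integrable D (fun t => (r * scalar_re (f t))%:E).
  by apply: eq_integrable (integrableZl mD r fr).
have Zi r : (mu_g g).-integrable D (fun t => (r * scalar_im (f t))%:E).
  by apply: eq_integrable (integrableZl mD r fi).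
apply: scalar_ext.
- rewrite scalar_reM !scalar_re_integral scalar_im_integral -!RintegralZl//.
  rewrite -RintegralB//; [|exact: Zr|exact: Zi].
  by apply: eq_Rintegral => t _; rewrite scalar_reM.
- rewrite scalar_imM !scalar_im_integral scalar_re_integral -!RintegralZl//.
  rewrite -RintegralD//; [|exact: Zi|exact: Zr].
  by apply: eq_Rintegral => t _; rewrite scalar_imM.
Qed.

(** Four real integrations by parts, one for each pair of components, recombined as in the product
    of two complex numbers. *)
Lemma integral_g_by_parts c f h :
  integrable_g `[a, c[%classic f -> integrable_g `[a, c[%classic h ->
  [/\ integrable_g `[a, c[%classic (fun t => integral_g g `[a, t[%classic f * h t),
      integrable_g `[a, c[%classic (fun t => f t * integral_g g `[a, t]%classic h)
    & integral_g g `[a, c[%classic (fun t => integral_g g `[a, t[%classic f * h t) +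
      integral_g g `[a, c[%classic (fun t => f t * integral_g g `[a, t]%classic h) =
      integral_g g `[a, c[%classic f * integral_g g `[a, c[%classic h].
Proof.
move=> [fr fi] [hr hi].
have mD : measurable (`[a, c[%classic : set LS) by exact: LS_measurable_itv.
have [r1 r2 rr] := Rintegral_by_parts fr hr.
have [s1 s2 ss] := Rintegral_by_parts fi hi.
have [p1 p2 pp] := Rintegral_by_parts fr hi.
have [q1 q2 qq] := Rintegral_by_parts fi hr.
split.
- split.
    apply: eq_integrable (integrableB mD r1 s1) => // t _.
    by rewrite scalar_reM scalar_re_integral scalar_im_integral.
  apply: eq_integrable (integrableD mD p1 q1) => // t _.
  by rewrite scalar_imM scalar_re_integral scalar_im_integral.
- split.
    apply: eq_integrable (integrableB mD r2 s2) => // t _.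
    by rewrite scalar_reM scalar_re_integral scalar_im_integral.
  apply: eq_integrable (integrableD mD p2 q2) => // t _.
  by rewrite scalar_imM scalar_re_integral scalar_im_integral.
- apply: scalar_ext.
    rewrite scalar_reD scalar_reM !scalar_re_integral !scalar_im_integral -rr -ss.
    rewrite opprD addrACA -!RintegralB//; congr (_ + _);
      by apply: eq_Rintegral => t _;
        rewrite scalar_reM scalar_re_integral scalar_im_integral.
  rewrite scalar_imD scalar_imM !scalar_re_integral !scalar_im_integral -pp -qq.
  rewrite [RHS]addrACA -[X in _ = X + _]RintegralD// -[X in _ = _ + X]RintegralD//; congr (_ + _);
    by apply: eq_Rintegral => t _;
      rewrite scalar_imM scalar_re_integral scalar_im_integral.
Qed.

End ScalarIntegral.

Arguments integrable_g {R k a b} g D f.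

(** * The posterior trace and the weak equation of a primitive *)

Section WeakDerivative.
Context {R : realType} {k : scalar_kind} {a b : R} (g : derivator a b).
Local Notation F := (scalar_field R k).
Local Notation LS := (caratheodory_type (R := R) (T := ocitv_type R)
  (wlength (derivator_right g))^*%mu).
Implicit Types (f h u v : R -> F).

Lemma integral_g_set0 f : integral_g g set0 f = 0.
Proof.
by apply: scalar_ext; rewrite ?scalar_re_integral ?scalar_im_integral
  Rintegral_set0 ?scalar_re0 ?scalar_im0.
Qed.

(** At a jump the right limit of the primitive takes in the atom; elsewhere the point has mass zero,
    and the integrals over [[a, t[] and [[a, t]] agree. *)
Lemma posterior_trace_primitive (phi psi : R -> F) t : L1_g g psi ->
  (forall s, s \in `[a, b] -> phi s = phi a + integral_g g `[a, s[%classic psi) ->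
  a <= t -> t < b ->
  posterior_trace g phi t = phi a + integral_g g `[a, t]%classic psi.
Proof.
move=> /L1_gP[pr pi] phiE at_ tb; rewrite /posterior_trace.
case: ifPn => [_|/negP nj]; last first.
  have {}nj : ~ jump_set g t by move=> j; apply: nj; exact/mem_set.
  rewrite phiE ?in_itv/= ?at_ ?ltW//; congr (_ + _).
  have m0 := mu_g_set1_nonjump at_ tb nj.
  apply: scalar_ext; rewrite ?scalar_re_integral ?scalar_im_integral.
    by rewrite (Rintegral_itvcc pr at_ tb) m0 mulr0 addr0.
  by rewrite (Rintegral_itvcc pi at_ tb) m0 mulr0 addr0.
apply/cvg_lim => //; apply/cvgrPdist_lt => e e0.
(* [e] is a positive element of [F]; each component receives half of its real part. *)
have e20 : 0 < scalar_re e / 2 by rewrite divr_gt0// scalar_re_gt0.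
have Hr := primitive_right_limit at_ tb pr e20.
have Hi := primitive_right_limit at_ tb pi e20.
near=> s.
have sb : s \in `[a, b].
  rewrite in_itv/=; apply/andP; split.
    by apply: le_trans at_ _; near: s; exact: nbhs_right_ge.
  by near: s; exact: nbhs_right_le.
rewrite distrC (phiE s)// opprD addrACA subrr add0r;
  apply: scalar_norm_lt => //.
apply: le_lt_trans (scalar_abs_le _) _; rewrite [ltRHS]splitr.
rewrite scalar_reD scalar_reN scalar_imD scalar_imN.
rewrite !scalar_re_integral !scalar_im_integral.
by apply: ltrD; near: s; [exact: Hr|exact: Hi].
Unshelve. all: by end_near. Qed.

(** With the constants [ua] and [phi a] pulled out of the integrals, what remains is integration by
    parts for [v] and [psi]; inserting [phi b] as [phi a] plus the integral of [psi] leaves an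
    algebraic identity. *)
Lemma weak_identity v (phi psi : R -> F) (ua : F) : a < b ->
  L1_g g v -> L1_g g psi ->
  (forall s, s \in `[a, b] -> phi s = phi a + integral_g g `[a, s[%classic psi) ->
  integral_g g `[a, b[%classic
    (fun t => (ua + integral_g g `[a, t[%classic v) * psi t) +
  integral_g g `[a, b[%classic (fun t => v t * posterior_trace g phi t) =
  (ua + integral_g g `[a, b[%classic v) * phi b - ua * phi a.
Proof.
move=> ab Lv Lpsi phiE.
have mD : measurable (`[a, b[%classic : set LS) by exact: LS_measurable_itv.
have vi := (L1_gP g v).1 Lv; have psii := (L1_gP g psi).1 Lpsi.
have [i1 i2 ibp] := integral_g_by_parts vi psii.
have -> : integral_g g `[a, b[%classic
    (fun t => (ua + integral_g g `[a, t[%classic v) * psi t) =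
    ua * integral_g g `[a, b[%classic psi +
    integral_g g `[a, b[%classic (fun t => integral_g g `[a, t[%classic v * psi t).
  rewrite -integral_gZ// -integral_gD//; last exact: integrable_gZ.
  by apply: eq_integral_g => t _; rewrite mulrDl.
have -> : integral_g g `[a, b[%classic (fun t => v t * posterior_trace g phi t) =
    phi a * integral_g g `[a, b[%classic v +
    integral_g g `[a, b[%classic (fun t => v t * integral_g g `[a, t]%classic psi).
  rewrite -integral_gZ// -integral_gD//; last exact: integrable_gZ.
  apply: eq_integral_g => t; rewrite inE/= in_itv/= => /andP[at_ tb].
  by rewrite (posterior_trace_primitive Lpsi phiE at_ tb) mulrDr mulrC.
rewrite addrACA ibp (phiE b) ?in_itv/= ?lexx ?(ltW ab)//.
ring.
Qed.

(** * Testing against primitives of indicators *)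

Lemma LS_measurableM f h : LS_measurable g f -> LS_measurable g h ->
  LS_measurable g (fun t => f t * h t).
Proof.
move=> [fr fi] [hr hi]; split.
- apply: eq_measurable_fun (measurable_funB (measurable_funM fr hr) (measurable_funM fi hi)).
  by move=> t _; rewrite scalar_reM.
- apply: eq_measurable_fun (measurable_funD (measurable_funM fr hi) (measurable_funM fi hr)).
  by move=> t _; rewrite scalar_imM.
Qed.

Definition scalar_indic (A : set R) (t : R) : F := mk_scalar (\1_A t) 0.

Lemma scalar_indic_integrable (A : set LS) : a <= b -> measurable A ->
  integrable_g g `[a, b[%classic (scalar_indic A).
Proof.
move=> ab mA.
have mD : measurable (`[a, b[%classic : set LS) by exact: LS_measurable_itv.
have Dfin : (mu_g g `[a, b[%classic < +oo)%E by exact: mu_g_fin.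
have Ai : (mu_g g).-integrable `[a, b[%classic (EFin \o (\1_A : LS -> R)).
  apply: (measurable_bounded_integrable mD Dfin); first exact: measurable_indic.
  exists 1; split => // x x1 t _; rewrite /= indicE.
  by case: (_ \in _); rewrite ?normr0 ?normr1 ltW// (lt_trans _ x1).
split.
- by apply: eq_integrable Ai => // t _; rewrite /= scalar_re_mk.
- by apply: eq_integrable (integrable0 _ _) => // t _; rewrite scalar_im_mk0.
Qed.

Lemma scalar_indic_Linfty (A : set LS) : a <= b -> measurable A ->
  Linfty_g g (scalar_indic A).
Proof.
move=> ab mA; have [ir ii] := scalar_indic_integrable ab mA; split.
  by split; [exact: integrable_on_measurable ir|exact: integrable_on_measurable ii].
exists 1; apply: nearW => t _; apply: le_trans (scalar_abs_le _) _.
rewrite scalar_re_mk scalar_im_mk0 normr0 addr0 indicE.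
by case: (_ \in _); rewrite ?normr0 ?normr1.
Qed.

(** The first integrability clause of integration by parts, with the constant one as second
    factor. *)
Lemma primitive_integrable (ua : F) v : a <= b -> L1_g g v ->
  integrable_g g `[a, b[%classic (fun t => ua + integral_g g `[a, t[%classic v).
Proof.
move=> ab /L1_gP vi.
have mD : measurable (`[a, b[%classic : set LS) by exact: LS_measurable_itv.
have one := scalar_indic_integrable ab (measurableT : measurable (setT : set LS)).
have [i1 _ _] := integral_g_by_parts vi one.
have [jr ji] := integrable_gD mD (integrable_gZ ua mD one) i1.
have E t : ua * scalar_indic [set: R] t + integral_g g `[a, t[%classic v * scalar_indic [set: R] t
    = ua + integral_g g `[a, t[%classic v.
  have -> : scalar_indic [set: R] t = 1.
    apply: scalar_ext; first by rewrite scalar_re_mk indicT scalar_re1.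
    by rewrite scalar_im_mk0 scalar_im1.
  by rewrite !mulr1.
by split; [apply: eq_integrable jr|apply: eq_integrable ji] => // t _;
  rewrite E.
Qed.

(** The test function is [c] plus the primitive of the indicator of [A]. Subtracting [weak_identity]
    for the same function cancels the trace integral and the term at [a]. *)
Lemma weak_derivative_test u v ua ub : a < b -> L1_g g v ->
  weak_derivative g u ua ub v -> forall (c : F) (A : set LS), measurable A ->
  integral_g g `[a, b[%classic (fun t => u t * scalar_indic A t) -
  integral_g g `[a, b[%classic
    (fun t => (ua + integral_g g `[a, t[%classic v) * scalar_indic A t) =
  (ub - (ua + integral_g g `[a, b[%classic v)) *
    (c + integral_g g `[a, b[%classic (scalar_indic A)).
Proof.
move=> ab Lv wd c A mA; have leab := ltW ab.
pose phi t := c + integral_g g `[a, t[%classic (scalar_indic A).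
have phia : phi a = c by rewrite /phi set_itvco0 integral_g_set0 addr0.
have phiE s : s \in `[a, b] ->
  phi s = phi a + integral_g g `[a, s[%classic (scalar_indic A).
  by rewrite phia.
have Lpsi : L1_g g (scalar_indic A) by apply/L1_gP;
  exact: scalar_indic_integrable.
have tphi : test_space g phi.
  by exists c, (scalar_indic A); split; [exact: scalar_indic_Linfty|].
have := wd _ _ tphi (conj Lpsi phiE).
have := weak_identity ua ab Lv Lpsi phiE.
rewrite -/(phi b) mulrBl => /(canRL (addrK _)) -> /(canRL (addrK _)) ->.
ring.
Qed.

Lemma Rintegral_mul_indic (f : R -> R) (A : set LS) : A `<=` `[a, b[ ->
  Rintegral (mu_g g) `[a, b[%classic (fun t => f t * \1_A t) = Rintegral (mu_g g) A f.
Proof.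
move=> AD; rewrite -[in RHS](setIidr AD) Rintegral_mkcondr;
  apply: eq_Rintegral => t _.
by rewrite patchE indicE; case: (t \in A); rewrite ?mulr1 ?mulr0.
Qed.

Lemma ae_eq_real_of_Rintegral (f h : R -> R) :
  (mu_g g).-integrable `[a, b[%classic (EFin \o (f : LS -> R)) ->
  (mu_g g).-integrable `[a, b[%classic (EFin \o (h : LS -> R)) ->
  (forall A : set LS, measurable A -> A `<=` `[a, b[ ->
    Rintegral (mu_g g) A f = Rintegral (mu_g g) A h) ->
  \forall t \ae mu_g g, `[a, b[%classic t -> f t = h t.
Proof.
move=> fi hi fh.
have mD : measurable (`[a, b[%classic : set LS) by exact: LS_measurable_itv.
have : ae_eq (mu_g g) `[a, b[%classic (EFin \o (f : LS -> R)) (EFin \o (h : LS -> R)).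
  apply: (integral_ae_eq mD fi); first exact: (measurable_int (mu_g g)).
  move=> A AD mA; have fA := integrableS mD mA AD fi;
    have hA := integrableS mD mA AD hi.
  rewrite -[LHS]fineK ?(integrable_fin_num mA fA)//.
  rewrite -[RHS]fineK ?(integrable_fin_num mA hA)//.
  by congr EFin; exact: fh.
by apply: filterS => t /[apply] -[].
Qed.

(** The endpoint value comes first; it makes the right side of [weak_derivative_test] vanish, so [u]
    and the primitive have equal integrals over all measurable subsets of [[a, b[]. *)
Lemma weak_derivative_primitive u v ua ub : a < b -> L1_g g u -> L1_g g v ->
  weak_derivative g u ua ub v ->
  eq_ae_g g (fun t => ua + integral_g g `[a, t[%classic v) u /\
  ua + integral_g g `[a, b[%classic v = ub.
Proof.
move=> ab /L1_gP[ur ui] Lv wd; have leab := ltW ab.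
have [Ur Ui] := primitive_integrable ua leab Lv.
have test := weak_derivative_test ab Lv wd.
have Ub : ua + integral_g g `[a, b[%classic v = ub.
  (* An empty [A] and [c = 1] give the test function equal to one. *)
  have := test 1 set0 measurable0.
  have z0 f : integral_g g `[a, b[%classic (fun t => f t * scalar_indic set0 t) = 0.
    apply: scalar_ext; rewrite ?scalar_re_integral ?scalar_im_integral ?scalar_re0 ?scalar_im0;
      rewrite /Rintegral integral0_eq// => t _;
      by rewrite ?scalar_reM ?scalar_imM scalar_re_mk scalar_im_mk0 indic0
        !mulr0 ?subr0 ?addr0.
  have -> : integral_g g `[a, b[%classic (scalar_indic set0 : R -> F) = 0.
    by apply: etrans (z0 (fun=> 1)); apply: eq_integral_g => t _; rewrite mul1r.
  by rewrite !z0 subr0 addr0 mulr1 => /esym/eqP; rewrite subr_eq0 => /eqP.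
split=> //.
have eqA (A : set LS) : measurable A -> A `<=` `[a, b[ ->
    integral_g g `[a, b[%classic (fun t => u t * scalar_indic A t) =
    integral_g g `[a, b[%classic
      (fun t => (ua + integral_g g `[a, t[%classic v) * scalar_indic A t).
  (* The endpoint factor is now zero, so the value of [c] is immaterial. *)
  move=> mA AD; apply/eqP; rewrite -subr_eq0 (test 0 A mA) Ub subrr mul0r//.
have reE (f : R -> F) (A : set LS) : A `<=` `[a, b[ ->
    scalar_re (integral_g g `[a, b[%classic (fun t => f t * scalar_indic A t)) =
    Rintegral (mu_g g) A (fun t => scalar_re (f t)).
  move=> AD; rewrite scalar_re_integral -[RHS](Rintegral_mul_indic _ AD);
    apply: eq_Rintegral => t _.
  by rewrite scalar_reM scalar_re_mk scalar_im_mk0 mulr0 subr0.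
have imE (f : R -> F) (A : set LS) : A `<=` `[a, b[ ->
    scalar_im (integral_g g `[a, b[%classic (fun t => f t * scalar_indic A t)) =
    Rintegral (mu_g g) A (fun t => scalar_im (f t)).
  move=> AD; rewrite scalar_im_integral -[RHS](Rintegral_mul_indic _ AD);
    apply: eq_Rintegral => t _.
  by rewrite scalar_imM scalar_re_mk scalar_im_mk0 mulr0 add0r.
have re_ae := ae_eq_real_of_Rintegral Ur ur.
have im_ae := ae_eq_real_of_Rintegral Ui ui.
apply: filterS2 (re_ae _) (im_ae _).
- by move=> t hr hi tD; apply: scalar_ext; [exact: hr|exact: hi].
- by move=> A mA AD; rewrite -reE// -eqA// reE.
- by move=> A mA AD; rewrite -imE// -eqA// imE.
Qed.

(** [weak_identity] is the weak equation of the primitive; passing to [u] alters the first integrand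
    only on a null set. *)
Lemma primitive_weak_derivative u v ua ub : a < b -> L1_g g u -> L1_g g v ->
  eq_ae_g g (fun t => ua + integral_g g `[a, t[%classic v) u ->
  ua + integral_g g `[a, b[%classic v = ub ->
  weak_derivative g u ua ub v.
Proof.
move=> ab [[mur mui] _] Lv Uu Ub phi psi _ [Lpsi phiE]; have leab := ltW ab.
have [Ur Ui] := primitive_integrable ua leab Lv.
have mD : measurable (`[a, b[%classic : set LS) by exact: LS_measurable_itv.
have mU : LS_measurable g (fun t => ua + integral_g g `[a, t[%classic v).
  by split; [exact: integrable_on_measurable Ur|exact: integrable_on_measurable Ui].
have [mur' mui'] := LS_measurableM (conj mur mui) Lpsi.1.
have [mUr mUi] := LS_measurableM mU Lpsi.1.
rewrite -Ub -(weak_identity ua ab Lv Lpsi phiE); congr (_ + _).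
apply: scalar_ext; rewrite ?scalar_re_integral ?scalar_im_integral.
  by apply: (ae_eq_Rintegral mD mur' mUr); apply: filterS Uu => t /[apply] <-.
by apply: (ae_eq_Rintegral mD mui' mUi); apply: filterS Uu => t /[apply] <-.
Qed.

(** * Absolute continuity and uniqueness of primitives *)

Lemma primitive_sub v s t : a <= s -> s <= t -> t <= b -> L1_g g v ->
  integral_g g `[a, t[%classic v - integral_g g `[a, s[%classic v =
  integral_g g `[s, t[%classic v.
Proof.
move=> as_ st tb /L1_gP[vr vi].
have mU c d : measurable (`[c, d[%classic : set LS) by exact: LS_measurable_itv.
have tE : `[a, t[%classic = `[a, s[%classic `|` `[s, t[%classic.
  by rewrite -itv_bndbnd_setU// bnd_simp.
have dsj : [disjoint `[a, s[%classic & `[s, t[%classic].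
  by apply/disj_setPS => x /=; rewrite !in_itv/= => -[/andP[_ xs] /andP[]];
    rewrite leNgt xs.
have key (f : R -> R) :
    (mu_g g).-integrable `[a, b[%classic (EFin \o (f : LS -> R)) ->
    Rintegral (mu_g g) `[a, t[%classic f - Rintegral (mu_g g) `[a, s[%classic f =
    Rintegral (mu_g g) `[s, t[%classic f.
  move=> fi; rewrite tE (Rintegral_setU (mU a s) (mU s t))//.
    by rewrite addrAC subrr add0r.
  by rewrite -tE; exact: integrable_onW tb.
apply: scalar_ext.
- by rewrite scalar_reD scalar_reN !scalar_re_integral key.
- by rewrite scalar_imD scalar_imN !scalar_im_integral key.
Qed.

Lemma bigsetU_itv_sub n (x y : 'I_n -> R) :
  (forall j, [/\ a <= x j, x j < y j & y j <= b]) ->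
  \big[setU/set0]_(j < n) `[x j, y j[%classic `<=` `[a, b[.
Proof.
move=> xy; apply: (big_ind (fun X => X `<=` `[a, b[)).
- exact: sub0set.
- by move=> X Y XD YD; rewrite subUset.
- by move=> j _; have [ax _ yb] := xy j; apply: subset_itv; rewrite bnd_simp.
Qed.

(** Triangle inequality on each interval, then additivity of the integral of [|f|] over the disjoint
    union. *)
Lemma sum_norm_Rintegral_le (f : R -> R) n (x y : 'I_n -> R) :
  (mu_g g).-integrable `[a, b[%classic (EFin \o (f : LS -> R)) ->
  (forall j, [/\ a <= x j, x j < y j & y j <= b]) ->
  trivIset [set: 'I_n] (fun j => `[x j, y j[%classic) ->
  \sum_(j < n) `|Rintegral (mu_g g) `[x j, y j[%classic f| <=
  Rintegral (mu_g g) (\big[setU/set0]_(j < n) `[x j, y j[%classic) (fun t => `|f t|).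
Proof.
move=> fi xy tI.
have mI (j : 'I_n) : measurable (`[x j, y j[%classic : set LS)
  by exact: LS_measurable_itv.
have mD : measurable (`[a, b[%classic : set LS) by exact: LS_measurable_itv.
have subI j : `[x j, y j[ `<=` `[a, b[.
  by have [ax _ yb] := xy j; apply: subset_itv; rewrite bnd_simp.
have fI j : (mu_g g).-integrable (`[x j, y j[%classic : set LS) (EFin \o (f : LS -> R)).
  exact: integrableS fi.
have mf := integrable_on_measurable fi.
rewrite -lee_fin [leRHS]fineK; last first.
  apply: integrable_fin_num; first exact: bigsetU_measurable.
  apply: (integrableS mD); first exact: bigsetU_measurable.
    exact: bigsetU_itv_sub.
  exact: integrable_norm.
rewrite ge0_integral_bigsetU//=; last 3 first.
- by rewrite /index_enum -enumT enum_uniq.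
- by apply: sub_trivIset tI.
- apply/measurable_EFinP; apply: measurableT_comp => //.
  apply: measurable_funS mf => //.
  exact: bigsetU_itv_sub.
rewrite -sumEFin; apply: lee_sum => j _.
rewrite EFin_normr_Rintegral//;
  apply: le_trans (le_abse_integral _ _ _) _ => //.
by apply/measurable_EFinP; apply: measurable_funS mf => //; exact: subI.
Qed.

(** The increments add up to at most the integrals of the absolute values of both components over
    the union of the intervals. The measure of that union is exactly the sum of the increments of
    [g], so absolute continuity of the integral applies. *)
Lemma primitive_AC v (ua : F) : a < b -> L1_g g v ->
  AC_g g (fun t => ua + integral_g g `[a, t[%classic v).
Proof.
move=> ab Lv e e0; have /L1_gP[vr vi] := Lv.
have e20 : 0 < e / 2 by rewrite divr_gt0.
have [r1 r10 H1] := integral_abs_continuous vr e20.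
have [r2 r20 H2] := integral_abs_continuous vi e20.
(* One threshold per component, each allowing [e / 2]. *)
exists (Num.min r1 r2); first by rewrite lt_min r10.
move=> n x y xy tI; rewrite lt_min => /andP[sr1 sr2].
have mI (j : 'I_n) : measurable (`[x j, y j[%classic : set LS)
  by exact: LS_measurable_itv.
pose A : set LS := \big[setU/set0]_(j < n) `[x j, y j[%classic.
have mA : measurable A by exact: bigsetU_measurable.
have AD : A `<=` `[a, b[ by exact: bigsetU_itv_sub.
have muA : mu_g g A = (\sum_(j < n) (g (y j) - g (x j)))%:E.
  rewrite /A (measure_bigsetU_ord (mu_g g))// -sumEFin; apply: eq_bigr => j _.
  by have [ax xyj yb] := xy j; rewrite -mu_g_itvco// ltW.
have lt1 := H1 A mA AD; have lt2 := H2 A mA AD.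
rewrite muA !lte_fin in lt1 lt2.
rewrite [ltRHS]splitr.
apply: le_lt_trans (ltrD (lt1 sr1) (lt2 sr2)).
apply: le_trans (lerD (sum_norm_Rintegral_le vr xy tI) (sum_norm_Rintegral_le vi xy tI)).
rewrite -big_split/=; apply: ler_sum => j _.
have [ax xyj yb] := xy j.
rewrite opprD addrACA subrr add0r primitive_sub// ?(ltW xyj)//.
apply: le_trans (scalar_abs_le _) _.
by rewrite scalar_re_integral scalar_im_integral.
Qed.

(** In each component the difference has a primitive that vanishes almost everywhere and at [b],
    hence everywhere by [primitive_ae0], and [primitive0_ae0] concludes. The value at [b] is a
    separate condition, as [b] lies outside [[a, b[]. *)
Lemma primitive_unique v1 v2 (ua : F) : a < b -> L1_g g v1 -> L1_g g v2 ->
  eq_ae_g g (fun t => ua + integral_g g `[a, t[%classic v1)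
    (fun t => ua + integral_g g `[a, t[%classic v2) ->
  integral_g g `[a, b[%classic v1 = integral_g g `[a, b[%classic v2 ->
  eq_ae_g g v1 v2.
Proof.
move=> ab /L1_gP[v1r v1i] /L1_gP[v2r v2i] eq12 eqb; have leab := ltW ab.
have key (p1 p2 : R -> R) :
    (mu_g g).-integrable `[a, b[%classic (EFin \o (p1 : LS -> R)) ->
    (mu_g g).-integrable `[a, b[%classic (EFin \o (p2 : LS -> R)) ->
    (\forall t \ae mu_g g, `[a, b[%classic t ->
      Rintegral (mu_g g) `[a, t[%classic p1 = Rintegral (mu_g g) `[a, t[%classic p2) ->
    Rintegral (mu_g g) `[a, b[%classic p1 = Rintegral (mu_g g) `[a, b[%classic p2 ->
    \forall t \ae mu_g g, `[a, b[%classic t -> p1 t = p2 t.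
  move=> i1 i2 eqt eqp.
  have i12 : (mu_g g).-integrable `[a, b[%classic (EFin \o ((fun t => p1 t - p2 t) : LS -> R)).
    exact: (integrableB (LS_measurable_itv g `[a, b[) i1 i2).
  have B t : t <= b -> Rintegral (mu_g g) `[a, t[%classic (fun s => p1 s - p2 s) =
      Rintegral (mu_g g) `[a, t[%classic p1 - Rintegral (mu_g g) `[a, t[%classic p2.
    move=> tb; apply: (RintegralB (LS_measurable_itv g `[a, t[)).
      exact: integrable_onW i1 tb.
    exact: integrable_onW i2 tb.
  have : \forall t \ae mu_g g, `[a, b[%classic t -> p1 t - p2 t = 0.
    apply: (primitive0_ae0 leab i12); apply: (primitive_ae0 leab i12).
      apply: filterS eqt => t ht tD; have := tD;
        rewrite /= in_itv/= => /andP[_ tb].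
      by rewrite B ?ltW// ht// subrr.
    by rewrite B// eqp subrr.
  by apply: filterS => t /[apply] /eqP; rewrite subr_eq0 => /eqP.
apply: filterS2 (key _ _ v1r v2r _ _) (key _ _ v1i v2i _ _).
- by move=> t hr hi tD; apply: scalar_ext; [exact: hr|exact: hi].
- apply: filterS eq12 => t /[apply] /addrI.
  by move=> /(congr1 scalar_re); rewrite !scalar_re_integral.
- by rewrite -!scalar_re_integral eqb.
- apply: filterS eq12 => t /[apply] /addrI.
  by move=> /(congr1 scalar_im); rewrite !scalar_im_integral.
- by rewrite -!scalar_im_integral eqb.
Qed.

End WeakDerivative.

(** * Equivalence of the three formulations, and uniqueness *)

Theorem theorem4p6 (R : realType) (k : scalar_kind) (a b : R) (hab : a < b)
    (g : derivator a b) (hg : 0 < g b - g a) :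
  (forall (u v : R -> scalar_field R k) (ua ub : scalar_field R k),
     L1_g g u -> L1_g g v ->
     (weak_derivative g u ua ub v <->
      exists U : R -> scalar_field R k,
        [/\ AC_g g U, eq_ae_g g U u, U a = ua, U b = ub
          & stieltjes_derivative g U v]) /\
     (weak_derivative g u ua ub v <->
      let U := fun t : R => ua + integral_g g `[a, t[%classic v in
      [/\ eq_ae_g g U u, U a = ua & U b = ub])) /\
  (forall (u v1 v2 : R -> scalar_field R k) (ua ub : scalar_field R k),
     L1_g g u -> L1_g g v1 -> L1_g g v2 ->
     weak_derivative g u ua ub v1 -> weak_derivative g u ua ub v2 ->
     eq_ae_g g v1 v2).
Proof.
split=> [u v ua ub Lu Lv|u v1 v2 ua ub Lu L1 L2 wd1 wd2]; last first.
  (* The primitives of [v1] and [v2] from [ua] both represent [u] and both end at [ub]. *)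
  have [Uu1 Ub1] := weak_derivative_primitive hab Lu L1 wd1.
  have [Uu2 Ub2] := weak_derivative_primitive hab Lu L2 wd2.
  apply: (primitive_unique (ua := ua) hab L1 L2).
    by apply: filterS2 Uu1 Uu2 => t h1 h2 tD; rewrite h1// h2.
  by apply: (addrI ua); rewrite Ub1 Ub2.
have Ua : ua + integral_g g `[a, a[%classic v = ua.
  by rewrite set_itvco0 integral_g_set0 addr0.
split; split.
- move=> /(weak_derivative_primitive hab Lu Lv)[Uu Ub].
  exists (fun t => ua + integral_g g `[a, t[%classic v); split=> //.
    exact: primitive_AC.
  by split=> // t _; rewrite Ua.
- move=> [U [_ Uu <- <- [_ UE]]].
  (* By [UE], [U] is on [[a, b]] the primitive of [v] from [U a], so its almost everywhere equality
     with [u] and its value at [b] pass to the primitive. *)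
  apply: primitive_weak_derivative => //.
    apply: filterS Uu => t ht tD; rewrite -ht//.
    rewrite (UE t)//; move: tD; rewrite /= !in_itv/= => /andP[-> tb].
    exact: ltW.
  by rewrite -UE// in_itv/= lexx (ltW hab).
- by move=> /(weak_derivative_primitive hab Lu Lv)[Uu Ub].
- by move=> /= [Uu _ Ub]; exact: primitive_weak_derivative.
Qed.
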